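(* Let $\mathbf{k}$ be a field of characteristic $0$. Let $A$ be a commutative algebra with identity over $\mathbf{k}$ with Gorenstein duality given by a linear function $\ell\colon A\to\mathbf{k}$. Let $V$ be a (possibly infinite dimensional) vector space over $\mathbf{k}$ and let $\pi\colon\mathrm{Sym}(V)\to A$ be a surjective homomorphism of algebras. Put $\widetilde\ell=\ell\circ\pi$. Then $$A\simeq \mathrm{Sym}(V)/\mathrm{Ann}(\mathrm{Exp}^*\widetilde\ell),$$ where $\mathrm{Ann}(\mathrm{Exp}^*\widetilde\ell)=\{P\in\mathrm{Sym}(V)\mid \mathcal{D}_P\cdot\mathrm{Exp}^*\widetilde\ell=0\}$.
   Context: A linear function $\ell$ on a commutative algebra $A$ gives a Gorenstein duality if the pairing $\langle a,b\rangle_\ell=\ell(ab)$ on $A$ is non-degenerate. $A$ is not assumed Artinian or finite dimensional. A function $f\colon V\to \mathbf{k}$ is a homogeneous polynomial of degree $d$ if its restriction to every finite dimensional subspace of $V$ is a homogeneous polynomial of degree $d$ (zero allowed). A formal polynomial series on $V$ is a formal sum $f=\sum_{i\ge 0} f_i$ with $f_i$ a homogeneous polynomial of degree $i$ on $V$; the space of these is $\mathbf{k}[[V]]$. For $v\in V$ and a polynomial $f$ on $V$, $L_vf$ is the derivative in direction $v$: $L_vf(x)=\lim_{t\to0}\frac{f(x+tv)-f(x)}{t}$, understood formally as the coefficient of $t$ in $f(x+tv)$. For $P\in\mathrm{Sym}(V)$ the constant coefficient differential operator $\mathcal{D}_P$ is defined by $\mathcal{D}_{v_1\cdots v_k}=L_{v_1}\cdots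 L_{v_k}$, $\mathcal{D}_1=\mathrm{id}$, and linearity; it acts on $\mathbf{k}[[V]]$ term by term. For a linear function $\widetilde\ell\colon\mathrm{Sym}(V)\to\mathbf{k}$, $\mathrm{Exp}^*\widetilde\ell\in\mathbf{k}[[V]]$ is the formal polynomial series $v\mapsto\sum_{i\ge 0}\widetilde\ell\left(\frac{v^i}{i!}\right)$, where $v^i$ is the $i$-th power of $v$ in $\mathrm{Sym}(V)$. *)

(* Defs.v *)
From HB Require Import structures.
From mathcomp Require Import all_boot all_algebra generic_quotient ring_quotient.
From mathcomp Require Import finmap.
From mathcomp Require Import monalg mpoly.
From mathcomp Require Import boolp ring.

Set Implicit Arguments.
Unset Strict Implicit.
Unset Printing Implicit Defensive.

Import GRing.Theory.
Local Open Scope ring_scope.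
Local Open Scope quotient_scope.

(* monalg and mpoly both define this notation; the polynomials of mpoly are
   the ones used here. *)
Local Notation "{ 'mpoly' T [ n ] }" := (mpoly n T) : type_scope.

(* The algebra structures of the library (comAlgType and the like) require
   1 != 0.  The structure below has the same axioms without this one, so that
   it includes the zero algebra. *)
HB.mixin Record ComPzRing_isAlgebra (k : pzRingType) (A : Type)
    of GRing.ComPzRing A := {
  pz_scale : k -> A -> A;
  pz_scaleA : forall c d a, pz_scale c (pz_scale d a) = pz_scale (c * d) a;
  pz_scale1 : left_id 1 pz_scale;
  pz_scaleDr : right_distributive pz_scale +%R;
  pz_scaleDl : forall a, {morph pz_scale^~ a : c d / c + d};
  pz_scaleAl : forall c a b, pz_scale c (a * b) = pz_scale c a * b
}.

#[short(type="comPzAlgType")]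
HB.structure Definition ComPzAlgebra (k : pzRingType) :=
  {A of GRing.ComPzRing A & ComPzRing_isAlgebra k A}.

HB.instance Definition _ (k : pzRingType) (A : comPzAlgType k) :=
  GRing.Zmodule_isLmodule.Build k (ComPzAlgebra.sort A)
    (@pz_scaleA k A) (@pz_scale1 k A) (@pz_scaleDr k A) (@pz_scaleDl k A).

Lemma pz_scalerAl (k : pzRingType) (A : comPzAlgType k) (c : k) (a b : A) :
  c *: (a * b) = (c *: a) * b.
Proof. exact: pz_scaleAl. Qed.

Lemma pz_scalerAr (k : pzRingType) (A : comPzAlgType k) (c : k) (a b : A) :
  c *: (a * b) = a * (c *: b).
Proof. by rewrite mulrC pz_scalerAl mulrC. Qed.

(* A linear form gives a Gorenstein duality when the pairing (a, b) |-> l (ab)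
   is non-degenerate.  The pairing is symmetric, so its left and right kernels
   agree. *)
Definition gorenstein_duality (k : pzRingType) (A : comPzAlgType k)
    (l : {scalar A}) : Prop :=
  forall a : A, (forall b : A, l (a * b) = 0) -> a = 0.

(* Unlike the idealr of ring_quotient, these ideals need not be proper. *)

Record ideal (R : comPzRingType) := Ideal {
  ideal_mem :> R -> Prop;
  ideal_mem0 : ideal_mem 0;
  ideal_memD : forall x y, ideal_mem x -> ideal_mem y -> ideal_mem (x + y);
  ideal_memM : forall a x, ideal_mem x -> ideal_mem (a * x)
}.

Lemma ideal_memN (R : comPzRingType) (I : ideal R) (x : R) : I x -> I (- x).
Proof. by move=> Ix; rewrite -mulN1r; apply: ideal_memM. Qed.

Definition ideal_pred (R : comPzRingType) (I : ideal R) : {pred R} :=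
  fun x => `[< I x >].

Lemma ideal_predP (R : comPzRingType) (I : ideal R) (x : R) :
  reflect (I x) (x \in ideal_pred I).
Proof. exact: asboolP. Qed.

Lemma ideal_pred_zmod_closed (R : comPzRingType) (I : ideal R) :
  zmod_closed (ideal_pred I).
Proof.
split; first by apply/ideal_predP/ideal_mem0.
move=> x y /ideal_predP Ix /ideal_predP Iy; apply/ideal_predP.
by apply: ideal_memD Ix _; apply: ideal_memN.
Qed.

HB.instance Definition _ (R : comPzRingType) (I : ideal R) :=
  GRing.isZmodClosed.Build R (ideal_pred I) (ideal_pred_zmod_closed I).

Definition alg_quot (R : comPzRingType) (I : ideal R) : Type :=
  Quotient.quot (ideal_pred I).

Section AlgQuot.
Variables (k : pzRingType) (R : comPzAlgType k) (I : ideal R).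
Local Notation Q := (alg_quot I).

HB.instance Definition _ := GRing.Zmodule.on Q.
HB.instance Definition _ : EqQuotient R (Quotient.equiv (ideal_pred I)) Q :=
  EqQuotient.on Q.

Definition quot_pi (x : R) : Q := \pi_Q x.

Lemma quot_piP (x y : R) : quot_pi x = quot_pi y <-> I (x - y).
Proof.
split=> [/eqP|H]; last apply/eqP; rewrite -Quotient.idealrBE.
  by move/ideal_predP.
exact/ideal_predP.
Qed.

Lemma quot_pi_surj (q : Q) : exists x, quot_pi x = q.
Proof. by exists (repr q); rewrite /quot_pi reprK. Qed.

Lemma quot_pi0 : quot_pi 0 = 0.
Proof. by rewrite /quot_pi piE. Qed.

Lemma quot_piD (x y : R) : quot_pi (x + y) = quot_pi x + quot_pi y.
Proof. by rewrite /quot_pi !piE. Qed.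

Definition quot_one : Q := lift_cst Q 1.
Definition quot_mul : Q -> Q -> Q := lift_op2 Q *%R.
Definition quot_scale (c : k) : Q -> Q := lift_op1 Q ( *:%R c).


Lemma ideal_repr (x : R) : I (repr (quot_pi x) - x).
Proof. by apply/quot_piP; rewrite /quot_pi reprK. Qed.

Lemma quot_piM (x y : R) : quot_mul (quot_pi x) (quot_pi y) = quot_pi (x * y).
Proof.
rewrite /quot_mul; unlock; apply/quot_piP; set x' := repr _; set y' := repr _.
have -> : x' * y' - x * y = y' * (x' - x) + x * (y' - y).
  by rewrite !mulrBr [y' * x']mulrC [y' * x]mulrC addrA subrK.
by apply: ideal_memD; apply: ideal_memM; apply: ideal_repr.
Qed.

Lemma quot_piZ (c : k) (x : R) : quot_scale c (quot_pi x) = quot_pi (c *: x).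
Proof.
rewrite /quot_scale; unlock; apply/quot_piP; rewrite -scalerBr -[_ - _]mul1r pz_scalerAl.
by apply: ideal_memM; apply: ideal_repr.
Qed.

Lemma quot_mulA : associative quot_mul.
Proof.
move=> x y z.
have [[[a <-] [b <-]] [c <-]] :=
  (quot_pi_surj x, quot_pi_surj y, quot_pi_surj z).
by rewrite !quot_piM mulrA.
Qed.

Lemma quot_mulC : commutative quot_mul.
Proof.
move=> x y; have [[a <-] [b <-]] := (quot_pi_surj x, quot_pi_surj y).
by rewrite !quot_piM mulrC.
Qed.

Lemma quot_pi1 : quot_pi 1 = quot_one.
Proof. by rewrite /quot_one; unlock. Qed.

Lemma quot_mul1 : left_id quot_one quot_mul.
Proof. by move=> x; have [a <-] := quot_pi_surj x; rewrite -quot_pi1 quot_piM mul1r. Qed.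

Lemma quot_mulDl : left_distributive quot_mul +%R.
Proof.
move=> x y z.
have [[[a <-] [b <-]] [c <-]] :=
  (quot_pi_surj x, quot_pi_surj y, quot_pi_surj z).
by rewrite -quot_piD !quot_piM -quot_piD mulrDl.
Qed.

HB.instance Definition _ := GRing.Zmodule_isComPzRing.Build Q
  quot_mulA quot_mulC quot_mul1 quot_mulDl.

Lemma quot_scaleA c d x : quot_scale c (quot_scale d x) = quot_scale (c * d) x.
Proof. by have [a <-] := quot_pi_surj x; rewrite !quot_piZ scalerA. Qed.

Lemma quot_scale1 : left_id 1 quot_scale.
Proof. by move=> x; have [a <-] := quot_pi_surj x; rewrite quot_piZ scale1r. Qed.

Lemma quot_scaleDr : right_distributive quot_scale +%R.
Proof.
move=> c x y; have [[a <-] [b <-]] := (quot_pi_surj x, quot_pi_surj y).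
by rewrite -quot_piD !quot_piZ -quot_piD scalerDr.
Qed.

Lemma quot_scaleDl x : {morph quot_scale^~ x : c d / c + d}.
Proof.
move=> c d; have [a <-] := quot_pi_surj x.
by rewrite !quot_piZ -quot_piD scalerDl.
Qed.

Lemma quot_scaleAl c x y : quot_scale c (quot_mul x y) = quot_mul (quot_scale c x) y.
Proof.
have [[a <-] [b <-]] := (quot_pi_surj x, quot_pi_surj y).
by rewrite !(quot_piZ, quot_piM) pz_scalerAl.
Qed.

HB.instance Definition _ := ComPzRing_isAlgebra.Build k Q
  quot_scaleA quot_scale1 quot_scaleDr quot_scaleDl quot_scaleAl.
HB.instance Definition _ :=
  GRing.Lmodule.copy Q (ComPzAlgebra.sort (Q : comPzAlgType k)).

End AlgQuot.

Section QuotMorphism.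
Variables (k : pzRingType) (R : comPzAlgType k) (I : ideal R).

Lemma quot_pi_is_linear : linear (quot_pi I).
Proof. by move=> c x y; rewrite quot_piD -quot_piZ. Qed.

HB.instance Definition _ :=
  GRing.isLinear.Build k R (alg_quot I) _ (quot_pi I) quot_pi_is_linear.

Lemma quot_pi_is_monoid_morphism : monoid_morphism (quot_pi I).
Proof. by split=> [|x y]; rewrite ?quot_pi1 // -quot_piM. Qed.

HB.instance Definition _ :=
  GRing.isMonoidMorphism.Build R (alg_quot I) (quot_pi I)
    quot_pi_is_monoid_morphism.

End QuotMorphism.

HB.instance Definition _ (k : comNzRingType) (V : choiceType) :=
  ComPzRing_isAlgebra.Build k (malg (cmonom V) k)
    (@scalerA _ _) (@scale1r _ _) (@scalerDr _ _)
    (fun a c d => scalerDl a c d) (@scalerAl _ _).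

Section Sym.
Variables (k : fieldType) (V : lmodType k).

(* Sym(V) is the quotient of the polynomial algebra on the set V by the ideal
   generated by the relations [c *: v + w] = c *: [v] + [w]. *)

Definition sym_var (v : V) : {malg k[{cmonom V}]} := << ucm v >>.

Definition sym_rel_mem (g : {malg k[{cmonom V}]}) : Prop :=
  forall I : ideal {malg k[{cmonom V}]},
    (forall (c : k) (v w : V),
       I (sym_var (c *: v + w) - (c *: sym_var v + sym_var w))) ->
    I g.

Fact sym_rel_mem0 : sym_rel_mem 0.
Proof. by move=> I _; apply: ideal_mem0. Qed.

Fact sym_rel_memD x y : sym_rel_mem x -> sym_rel_mem y -> sym_rel_mem (x + y).
Proof. by move=> Ix Iy I IV; apply: ideal_memD; [apply: Ix|apply: Iy]. Qed.

Fact sym_rel_memM a x : sym_rel_mem x -> sym_rel_mem (a * x).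
Proof. by move=> Ix I IV; apply: ideal_memM; apply: Ix. Qed.

Definition sym_ideal : ideal {malg k[{cmonom V}]} :=
  Ideal sym_rel_mem0 sym_rel_memD sym_rel_memM.

Definition sym : Type := alg_quot sym_ideal.

HB.instance Definition _ := ComPzAlgebra.on sym.
HB.instance Definition _ := GRing.Lmodule.on sym.

Definition sym_inj (v : V) : sym := quot_pi sym_ideal (sym_var v).

Lemma sym_inj_is_linear : linear sym_inj.
Proof.
move=> c v w; rewrite /sym_inj -[RHS]linearP; apply/quot_piP => I IV.
exact: IV.
Qed.

HB.instance Definition _ :=
  GRing.isLinear.Build k V sym _ sym_inj sym_inj_is_linear.

Definition mon_word (m : {cmonom V}) : seq V :=
  flatten [seq nseq (m v) v | v <- finsupp m].

Fact count_mon_word (m : {cmonom V}) v : count_mem v (mon_word m) = m v.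
Proof.
rewrite /mon_word count_flatten -map_comp sumnE big_map.
rewrite (eq_bigr (fun w => if w == v then m v else 0)%N) => [|w _]; last first.
  by rewrite /= count_nseq /=; case: eqP => [->|]; rewrite ?mul1n.
rewrite -big_mkcond /= big_const_seq.
rewrite (count_uniq_mem _ (fset_uniq _)).
by case: monalg.mdomP => [vm|vm]; rewrite ?vm ?(negPf vm) /= ?addn0.
Qed.

Fact malgMUU (c c' : k) (m m' : {cmonom V}) :
  << c *g m >> * << c' *g m' >> =
  << c * c' *g monalg.mul m m' >> :> {malg k[{cmonom V}]}.
Proof. by rewrite [LHS]monalg.malgM_def monalg.fgmulUU. Qed.

Fact mon_word1 : mon_word (monalg.one : {cmonom V}) = [::].
Proof. by apply/perm_nilP/allP => v _; rewrite /= count_mon_word monalg.cm1. Qed.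

Fact monE (m : {cmonom V}) :
  << m >> = \prod_(v <- mon_word m) sym_var v :> {malg k[{cmonom V}]}.
Proof.
have E s : \prod_(v <- s) sym_var v =
    << \big[monalg.mul/monalg.one]_(v <- s) ucm v >> :> {malg k[{cmonom V}]}.
  elim: s => [|v s IH]; first by rewrite !big_nil.
  rewrite !big_cons IH; apply: etrans (malgMUU _ _ _ _) _.
  rewrite (mulr1 (1 : k)); reflexivity.
rewrite E; congr (<< _ >>); apply/eqP/cmP => v; rewrite -count_mon_word.
elim: (mon_word m) => [|w s IH]; first by rewrite big_nil monalg.cm1.
by rewrite big_cons monalg.cmM monalg.cmU -IH.
Qed.

Lemma sym_ind (S : sym -> Prop) :
  (forall c P Q, S P -> S Q -> S (c *: P + Q)) ->
  (forall s : seq V, S (\prod_(v <- s) sym_inj v)) ->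
  forall P, S P.
Proof.
move=> SD Sprod P; have S0 : S 0.
  by rewrite -(addNr (\prod_(v <- [::]) sym_inj v)) -scaleN1r; apply: SD.
have [g <-] := quot_pi_surj P; rewrite (monalgE g) linear_sum.
elim/big_rec: _ => // m Q _; set c := monalg.mcoeff m g.
have -> : << c *g m >> = c *: << m >> :> {malg k[{cmonom V}]}.
  rewrite -monalg.mul_malgC; apply/esym; apply: etrans (malgMUU _ _ _ _) _.
  by rewrite (mulr1 c) monalg.mul1m.
rewrite linearZ; apply: SD; rewrite monE rmorph_prod; exact: Sprod.
Qed.

End Sym.

Fact dhomog_var (R : comNzRingType) n (j : 'I_n) :
  ('X_j : {mpoly R[n]}) \is 1.-homog.
Proof. by rewrite dhomogX; apply/eqP/mdeg1. Qed.

Fact dhomog_comp (R : comNzRingType) n m d (p : {mpoly R[n]})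
    (X : n.-tuple {mpoly R[m]}) :
  p \is d.-homog -> (forall i, tnth X i \is 1.-homog) ->
  p \mPo X \is d.-homog.
Proof.
move=> pd Xd; rewrite comp_mpolyE big_seq rpred_sum // => e pe.
rewrite rpredZ // -(dhomog_mf pd pe) /= mdegE.
elim/big_rec2: _ => [|i a b _ bP]; first exact: dhomog1.
by apply: dhomogM bP; rewrite -[a in a.-homog]mul1n; apply: dhomogMn.
Qed.

Section FormalSeries.
Variables (k : fieldType) (V : lmodType k).

Definition lin_indep (n : nat) (u : 'I_n -> V) : Prop :=
  forall c : 'I_n -> k, \sum_i c i *: u i = 0 -> forall i, c i = 0.

(* On the subspace with basis u, a homogeneous polynomial of degree d is a
   homogeneous polynomial of degree d in the coordinates. *)
Definition homog_poly (d : nat) (f : V -> k) : Prop :=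
  forall (n : nat) (u : 'I_n -> V), lin_indep u ->
  exists2 p : {mpoly k[n]}, p \is d.-homog &
    forall t : 'I_n -> k, f (\sum_i t i *: u i) = p.@[t].

(* The formal series in k[[V]], given by their homogeneous terms. *)
Record fseries := FSeries {
  fs_term :> nat -> V -> k;
  fs_homog : forall d, homog_poly d (fs_term d)
}.

Lemma fseriesP (f g : fseries) : (forall d v, f d v = g d v) <-> f = g.
Proof.
split=> [fg|-> //]; case: f g fg => [f fP] [g gP] /= fg.
have fg' : f = g by apply/funext => d; apply/funext => v.
by case: _ / fg' in gP *; rewrite (Prop_irrelevance fP gP).
Qed.

HB.instance Definition _ := gen_eqMixin fseries.
HB.instance Definition _ := gen_choiceMixin fseries.

Fact homog_poly0 d : homog_poly d (fun=> 0).
Proof. by move=> n u _; exists 0 => [|t]; rewrite ?dhomog0 // meval0. Qed.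

Fact homog_polyP d c f g : homog_poly d f -> homog_poly d g ->
  homog_poly d (fun v => c * f v + g v).
Proof.
move=> fP gP n u uP; have [[p pd fE] [q qd gE]] := (fP n u uP, gP n u uP).
exists (c *: p + q) => [|t]; first by rewrite rpredD // rpredZ.
by rewrite fE gE mevalD mevalZ.
Qed.

Fact homog_polyD d f g : homog_poly d f -> homog_poly d g ->
  homog_poly d (fun v => f v + g v).
Proof.
move=> fP gP; have := homog_polyP 1 fP gP; congr homog_poly.
by apply/funext => v; rewrite mul1r.
Qed.

Fact homog_polyZ d c f : homog_poly d f -> homog_poly d (fun v => c * f v).
Proof.
move=> fP; have := homog_polyP c fP (@homog_poly0 d); congr homog_poly.
by apply/funext => v; rewrite addr0.
Qed.

Fact homog_polyN d f : homog_poly d f -> homog_poly d (fun v => - f v).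
Proof.
move=> fP; have := homog_polyZ (-1) fP; congr homog_poly.
by apply/funext => v; rewrite mulN1r.
Qed.

Definition fs_zero := FSeries homog_poly0.
Definition fs_opp (f : fseries) :=
  FSeries (fun d => homog_polyN (fs_homog f d)).
Definition fs_add (f g : fseries) :=
  FSeries (fun d => homog_polyD (fs_homog f d) (fs_homog g d)).
Definition fs_scale (c : k) (f : fseries) :=
  FSeries (fun d => homog_polyZ c (fs_homog f d)).

Fact fs_addA : associative fs_add.
Proof. by move=> f g h; apply/fseriesP => d v /=; rewrite addrA. Qed.
Fact fs_addC : commutative fs_add.
Proof. by move=> f g; apply/fseriesP => d v /=; rewrite addrC. Qed.
Fact fs_add0 : left_id fs_zero fs_add.
Proof. by move=> f; apply/fseriesP => d v /=; rewrite add0r. Qed.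
Fact fs_addN : left_inverse fs_zero fs_opp fs_add.
Proof. by move=> f; apply/fseriesP => d v /=; rewrite addNr. Qed.

HB.instance Definition _ :=
  GRing.isZmodule.Build fseries fs_addA fs_addC fs_add0 fs_addN.

Fact fs_scaleA c e f : fs_scale c (fs_scale e f) = fs_scale (c * e) f.
Proof. by apply/fseriesP => d v /=; rewrite mulrA. Qed.
Fact fs_scale1 : left_id 1 fs_scale.
Proof. by move=> f; apply/fseriesP => d v /=; rewrite mul1r. Qed.
Fact fs_scaleDr : right_distributive fs_scale +%R.
Proof. by move=> c f g; apply/fseriesP => d v /=; rewrite mulrDr. Qed.
Fact fs_scaleDl f : {morph fs_scale^~ f : c e / c + e}.
Proof. by move=> c e; apply/fseriesP => d v /=; rewrite mulrDl. Qed.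

HB.instance Definition _ := GRing.Zmodule_isLmodule.Build k fseries
  fs_scaleA fs_scale1 fs_scaleDr fs_scaleDl.

Lemma fs0E d v : (0 : fseries) d v = 0. Proof. by []. Qed.
Lemma fsDE (f g : fseries) d v : (f + g) d v = f d v + g d v.
Proof. by []. Qed.
Lemma fsZE c (f : fseries) d v : (c *: f) d v = c * f d v.
Proof. by []. Qed.

(* The coefficient of t in f (x + t v), when this is a polynomial in t. *)
Definition dir_deriv (v : V) (f : V -> k) (x : V) : k :=
  if pselect (exists q : {poly k}, forall t, f (x + t *: v) = q.[t]) is left e
  then (projT1 (cid e))`_1 else 0.

Lemma homog_poly_family d f n (u : 'I_n -> V) : homog_poly d f ->
  exists2 p : {mpoly k[n]}, p \is d.-homog &
    forall t : 'I_n -> k, f (\sum_i t i *: u i) = p.@[t].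
Proof.
move=> fP; elim: n u => [|n IHn] u; first by apply: fP => c _ [].
have [uP|uP] := pselect (lin_indep u); first exact: fP.
have [c [c0 [j cj]]] : exists c, \sum_i c i *: u i = 0 /\ exists j, c j != 0.
  apply: contrapT => N; apply: uP => c c0 i; apply: contrapT => /eqP ci.
  by apply: N; exists c; split=> //; exists i.
pose e i := - (c j)^-1 * c (lift j i).
have uj : u j = \sum_i e i *: u (lift j i).
  move: c0; rewrite (bigD1_ord j) //= => /eqP; rewrite addr_eq0 => /eqP uj.
  rewrite -[u j]scale1r -(mulVf cj) -scalerA uj scalerN scaler_sumr -sumrN.
  by apply: eq_bigr => i _; rewrite /e mulNr scaleNr scalerA.
have [p pd fE] := IHn (u \o lift j).
pose X i : {mpoly k[n.+1]} := 'X_(lift j i) + e i *: 'X_j.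
exists (p \mPo [tuple X i | i < n]) => [|t].
  apply: dhomog_comp => // i; rewrite tnth_mktuple.
  by rewrite rpredD ?rpredZ // dhomog_var.
rewrite comp_mpoly_meval (bigD1_ord j) //= uj.
have -> : (fun i => (tnth [tuple X i | i < n] i).@[t]) =
          (fun i => t (lift j i) + t j * e i).
  apply/funext => i; rewrite tnth_mktuple mevalD mevalZ !mevalXU.
  by rewrite mulrC.
rewrite -fE; congr f; rewrite scaler_sumr -big_split /=.
by apply: eq_bigr => i _; rewrite scalerDl scalerA addrC.
Qed.


(* In characteristic 0 the polynomial of dir_deriv is unique. *)
Hypothesis char0 : [pchar k] =i pred0.

Fact poly_ext (q r : {poly k}) : (forall t, q.[t] = r.[t]) -> q = r.
Proof.
move=> qr; apply/eqP; rewrite -subr_eq0; apply: contraT => q0.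
pose rs : seq k := [seq i%:R | i <- iota 0 (size (q - r)).+1].
have : (size rs < size (q - r)%R)%N.
  apply: max_poly_roots q0 _ _.
    by apply/allP => t _; rewrite rootE !hornerE qr subrr.
  rewrite map_inj_uniq ?iota_uniq // => i j /eqP.
  wlog ij : i j / (i <= j)%N => [H|].
    by case: (leqP i j) => [/H//|/ltnW/H] P; rewrite eq_sym => /P ->.
  rewrite eq_sym -subr_eq0 -natrB // ((pcharf0P k).1 char0) subn_eq0 => ji.
  by apply/eqP; rewrite eqn_leq ij.
by rewrite size_map size_iota ltnNge leqnSn.
Qed.

Fact dir_deriv_unique (v : V) (f : V -> k) (x : V) (q : {poly k}) :
  (forall t, f (x + t *: v) = q.[t]) -> dir_deriv v f x = q`_1.
Proof.
move=> fq; rewrite /dir_deriv; case: pselect => [e|[]]; last by exists q.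
case: cid => r fr /=; suff -> : r = q by [].
by apply: poly_ext => t; rewrite -fr fq.
Qed.

Fact mpoly_line n (p : {mpoly k[n]}) (s a : 'I_n -> k) :
  exists2 q : {poly k}, forall t, q.[t] = p.@[fun i => s i + t * a i] &
    q`_1 = \sum_i a i * (p^`M(i)).@[s].
Proof.
pose h i : {poly k} := (s i)%:P + a i *: 'X.
pose Q := mpoly.mmap polyC h.
have QE r t : (Q r).[t] = r.@[fun i => s i + t * a i].
  rewrite /Q /meval /mpoly.mmap horner_sum; apply: eq_bigr => m _.
  rewrite hornerM hornerC /mmap1 horner_prod; congr (_ * _).
  apply: eq_bigr => i _; rewrite horner_exp; congr (_ ^+ _).
  by rewrite /h !hornerE mulrC.
have Q0 r : (Q r)`_0 = r.@[s].
  rewrite -horner_coef0 QE; congr (_.@[_]); apply/funext => i.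
  by rewrite mul0r addr0.
exists (Q p) => //.
pose P r := (Q r)`_1 = \sum_i a i * (r^`M(i)).@[s].
have PM r1 r2 : P r1 -> P r2 -> P (r1 * r2).
  rewrite /P => P1 P2; rewrite /Q rmorphM /= coefM !big_ord_recr big_ord0 /=.
  rewrite add0r subn0 subnn -/(Q r1) -/(Q r2) !Q0 P1 P2.
  rewrite mulr_sumr mulr_suml -big_split /=; apply: eq_bigr => i _.
  by rewrite mderivM mevalD !mevalM; ring.
have P1 : P 1.
  rewrite /P /Q rmorph1 coef1 big1 // => i _.
  by rewrite -mpolyC1 mderivC meval0 mulr0.
have PX i : P 'X_i.
  rewrite /P /Q mmapX mmap1U /h coefD coefC coefZ coefX /= add0r mulr1.
  rewrite (bigD1 i) //= big1 => [|j ji]; rewrite mderivX.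
    by rewrite mnm1E eqxx scale1r -{1}[U_(i)%MM]add0m addmK mpolyX0 meval1 mulr1 addr0.
  by rewrite mnm1E eq_sym (negPf ji) scale0r meval0 mulr0.
rewrite -/(P p); elim/mpolyind: p => [|c m r _ _ IH].
  rewrite /P /Q rmorph0 coef0 big1 // => i _.
  by rewrite mderiv0 meval0 mulr0.
have Pm : P 'X_[m].
  rewrite mpolyXE_id; elim/big_ind: _ => // i _.
  by elim: (m i) => [|e IHe]; rewrite ?expr0 // exprS; apply: PM.
rewrite /P /Q rmorphD /= mmapZ coefD coefCM -/(Q r) IH -/(Q 'X_[m]) Pm.
rewrite mulr_sumr -big_split /=; apply: eq_bigr => i _.
by rewrite mderivD mderivZ mevalD mevalZ; ring.
Qed.

Fact dir_deriv_family f n (u : 'I_n -> V) (p : {mpoly k[n]}) :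
  (forall t, f (\sum_i t i *: u i) = p.@[t]) ->
  forall s a, dir_deriv (\sum_i a i *: u i) f (\sum_i s i *: u i) =
              \sum_i a i * (p^`M(i)).@[s].
Proof.
move=> fE s a; have [q qE <-] := mpoly_line p s a.
apply: dir_deriv_unique => t; rewrite qE -fE; congr f.
rewrite scaler_sumr -big_split /=; apply: eq_bigr => i _.
by rewrite scalerDl scalerA.
Qed.

Fact sum_delta n (u : 'I_n -> V) i : \sum_j (j == i)%:R *: u j = u i.
Proof.
rewrite (bigD1 i) //= eqxx scale1r big1 ?addr0 // => j /negPf ->.
by rewrite scale0r.
Qed.

Fact dir_deriv_vec f n (u : 'I_n -> V) (p : {mpoly k[n]}) i :
  (forall t, f (\sum_i t i *: u i) = p.@[t]) ->
  forall s, dir_deriv (u i) f (\sum_i s i *: u i) = (p^`M(i)).@[s].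
Proof.
move=> fE s; rewrite -[u i]sum_delta (dir_deriv_family fE).
rewrite (bigD1 i) //= eqxx mul1r big1 ?addr0 // => j /negPf ->.
by rewrite mul0r.
Qed.

Fact dhomog_mderiv n d (p : {mpoly k[n]}) i :
  p \is d.+1.-homog -> p^`M(i) \is d.-homog.
Proof.
move=> pd; apply/dhomogP => m; rewrite mcoeff_msupp mcoeff_mderiv => pm.
have : (m + U_(i))%MM \in msupp p.
  by rewrite mcoeff_msupp; apply: contraNneq pm => ->; rewrite mul0rn.
by move/(dhomog_mf pd); rewrite /= mdegD mdeg1 addn1 => -[].
Qed.

Fact homog_poly_dir_deriv d v f :
  homog_poly d.+1 f -> homog_poly d (dir_deriv v f).
Proof.
move=> fP n u _.
pose u' (i : 'I_n.+1) := if unlift ord0 i is Some j then u j else v.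
have [p pd fE] := homog_poly_family u' fP.
pose X : n.+1.-tuple {mpoly k[n]} :=
  [tuple if unlift ord0 i is Some j then 'X_j else 0 | i < n.+1].
exists (p^`M(ord0) \mPo X) => [|t].
  apply: dhomog_comp (dhomog_mderiv _ pd) _ => i; rewrite tnth_mktuple.
  by case: unlift => [j|]; rewrite ?rpred0 // dhomog_var.
pose t' (i : 'I_n.+1) := if unlift ord0 i is Some j then t j else 0.
have -> : \sum_i t i *: u i = \sum_i t' i *: u' i.
  rewrite big_ord_recl /t' /u' unlift_none scale0r add0r.
  by apply: eq_bigr => i _; rewrite liftK.
have {1}-> : v = u' ord0 by rewrite /u' unlift_none.
rewrite (dir_deriv_vec _ fE) comp_mpoly_meval; congr (_.@[_]).
apply/funext => i; rewrite tnth_mktuple /t'; case: unlift => [j|].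
  by rewrite mevalXU.
by rewrite meval0.
Qed.

(* L_v acts term by term on the formal sum f and lowers degrees by one, so the
   term of degree d of L_v f is L_v of the term of degree d.+1 of f. *)
Definition Lderiv (v : V) (f : fseries) : fseries :=
  FSeries (fun d => homog_poly_dir_deriv v (fs_homog f d.+1)).

Lemma LderivE v (f : fseries) d x : Lderiv v f d x = dir_deriv v (f d.+1) x.
Proof. by []. Qed.

Let vec3 (x v w : V) (i : 'I_3) : V := nth 0 [:: x; v; w] i.
Let scal3 (a b c : k) (i : 'I_3) : k := nth 0 [:: a; b; c] i.
Let i1 : 'I_3 := @Ordinal 3 1 isT.
Let i2 : 'I_3 := @Ordinal 3 2 isT.

Fact sum_vec3 (x v w : V) (a b c : k) :
  \sum_i scal3 a b c i *: vec3 x v w i = a *: x + b *: v + c *: w.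
Proof. by rewrite !big_ord_recl big_ord0 /= addr0 addrA. Qed.

Fact point_vec3 (x v w : V) : x = \sum_i scal3 1 0 0 i *: vec3 x v w i.
Proof. by rewrite sum_vec3 scale1r !scale0r !addr0. Qed.

Lemma Lderiv_is_linear v : linear (Lderiv v).
Proof.
move=> c f g; apply/fseriesP => d x.
rewrite fsDE fsZE !LderivE; pose u := vec3 x v 0.
have [p _ fE] := homog_poly_family u (fs_homog f d.+1).
have [q _ gE] := homog_poly_family u (fs_homog g d.+1).
have hE t : (c *: f + g) d.+1 (\sum_i t i *: u i) = (c *: p + q).@[t].
  by rewrite fsDE fsZE fE gE mevalD mevalZ.
rewrite (point_vec3 x v 0) -/u -[v]/(u i1).
rewrite (dir_deriv_vec _ fE) (dir_deriv_vec _ gE) (dir_deriv_vec _ hE).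
by rewrite mderivD mderivZ mevalD mevalZ.
Qed.

HB.instance Definition _ v :=
  GRing.isLinear.Build k fseries fseries _ (Lderiv v) (Lderiv_is_linear v).

Lemma Lderiv_linear_dir c v w (f : fseries) :
  Lderiv (c *: v + w) f = c *: Lderiv v f + Lderiv w f.
Proof.
apply/fseriesP => d x; rewrite fsDE fsZE !LderivE; pose u := vec3 x v w.
have [p _ fE] := homog_poly_family u (fs_homog f d.+1).
have -> : c *: v + w = \sum_i scal3 0 c 1 i *: u i.
  by rewrite sum_vec3 scale0r add0r scale1r.
rewrite (point_vec3 x v w) -/u (dir_deriv_family fE).
rewrite -[v]/(u i1) -[w]/(u i2) !(dir_deriv_vec _ fE).
rewrite !big_ord_recl big_ord0 /scal3 /= mul0r mul1r add0r addr0.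
by congr (_ * (p^`M(_)).@[_] + (p^`M(_)).@[_]); apply: val_inj.
Qed.

Lemma LderivC v w (f : fseries) : Lderiv v (Lderiv w f) = Lderiv w (Lderiv v f).
Proof.
apply/fseriesP => d x; rewrite !LderivE; pose u := vec3 x v w.
have [p _ fE] := homog_poly_family u (fs_homog f d.+2).
have vE t : Lderiv v f d.+1 (\sum_i t i *: u i) = (p^`M(i1)).@[t].
  by rewrite LderivE -[v]/(u i1) (dir_deriv_vec _ fE).
have wE t : Lderiv w f d.+1 (\sum_i t i *: u i) = (p^`M(i2)).@[t].
  by rewrite LderivE -[w]/(u i2) (dir_deriv_vec _ fE).
rewrite (point_vec3 x v w) -/u.
transitivity ((p^`M(i2))^`M(i1)).@[scal3 1 0 0].
  exact: (dir_deriv_vec i1 wE).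
by rewrite mderiv_comm; apply/esym; exact: (dir_deriv_vec i2 vE).
Qed.


(* D_P is computed on a representative of P in the polynomial algebra on V.
   By diffop_pi the choice does not matter; diffop1, diffop_prod and
   diffop_linear_op are the equations that define D. *)

Definition diffop_word (s : seq V) (f : fseries) : fseries :=
  foldr Lderiv f s.

Definition diffop_free (g : {malg k[{cmonom V}]}) (f : fseries) : fseries :=
  \sum_(m <- monalg.msupp g) monalg.mcoeff m g *: diffop_word (mon_word m) f.

Definition diffop (P : sym V) (f : fseries) : fseries :=
  diffop_free (repr (P : alg_quot _)) f.

Fact diffop_word_cons v s f :
  diffop_word (v :: s) f = Lderiv v (diffop_word s f).
Proof. by []. Qed.

Fact diffop_word_is_linear s : linear (diffop_word s).
Proof.
by elim: s => // v s IH c f g; rewrite !diffop_word_cons IH linearP.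
Qed.

HB.instance Definition _ s :=
  GRing.isLinear.Build k fseries fseries _ (diffop_word s)
    (diffop_word_is_linear s).

Fact diffop_word_cat s t f :
  diffop_word (s ++ t) f = diffop_word s (diffop_word t f).
Proof. exact: foldr_cat. Qed.

Fact diffop_word_perm s t f :
  perm_eq s t -> diffop_word s f = diffop_word t f.
Proof.
elim: s t => [|v s IH] t st; first by move: st; rewrite perm_sym => /perm_nilP ->.
have vt : v \in t by rewrite -(perm_mem st) mem_head.
case/splitPr: vt st => t1 t2 st.
rewrite diffop_word_cons (IH (t1 ++ t2)); last first.
  rewrite -(perm_cons v); apply: perm_trans st _.
  by rewrite -[v :: t2]cat1s perm_catCA.
rewrite !diffop_word_cat diffop_word_cons.
by elim: t1 {st} => // w t1 IHt; rewrite !diffop_word_cons LderivC IHt.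
Qed.

Fact diffop_word_mon (m m' : {cmonom V}) f :
  diffop_word (mon_word (monalg.mul m m')) f =
  diffop_word (mon_word m) (diffop_word (mon_word m') f).
Proof.
rewrite -diffop_word_cat; apply: diffop_word_perm.
by apply/allP => v _ /=; rewrite count_cat !count_mon_word monalg.cmM.
Qed.

Fact diffop_freeE (d : {fset {cmonom V}}) g f :
  (monalg.msupp g `<=` d)%fset ->
  diffop_free g f =
  \sum_(m <- d) monalg.mcoeff m g *: diffop_word (mon_word m) f.
Proof.
move=> gd; apply: big_fset_incl => // m _ /mcoeff_outdom ->.
by rewrite scale0r.
Qed.

Fact diffop_free_linear_op f c g h :
  diffop_free (c *: g + h) f = c *: diffop_free g f + diffop_free h f.
Proof.
pose d := (monalg.msupp g `|` monalg.msupp h)%fset.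
rewrite !(@diffop_freeE d) ?fsubsetUl ?fsubsetUr //.
  rewrite scaler_sumr -big_split /=; apply: eq_bigr => m _.
  by rewrite monalg.mcoeffD monalg.mcoeffZ scalerDl scalerA.
apply: fsubset_trans (monalg.msuppD_le _ _) _.
by rewrite fsetSU // monalg.msuppZ_le.
Qed.

Fact diffop_freeU f c m :
  diffop_free << c *g m >> f = c *: diffop_word (mon_word m) f.
Proof.
rewrite (@diffop_freeE [fset m]%fset) ?monalg.msuppU_le //.
by rewrite big_seq_fset1 monalg.mcoeffUU.
Qed.

Fact diffop_free_is_linear g : linear (diffop_free g).
Proof.
move=> c f f'; rewrite /diffop_free scaler_sumr -big_split /=.
apply: eq_bigr => m _; rewrite linearP scalerDr !scalerA.
by rewrite [_ * c]mulrC.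
Qed.

HB.instance Definition _ g :=
  GRing.isLinear.Build k fseries fseries _ (diffop_free g)
    (diffop_free_is_linear g).

Fact diffop_free0 f : diffop_free 0 f = 0.
Proof. by rewrite /diffop_free monalg.msupp0 big_seq_fset0. Qed.

Fact diffop_freeD f g h : diffop_free (g + h) f = diffop_free g f + diffop_free h f.
Proof. by rewrite -{1}[g]scale1r diffop_free_linear_op scale1r. Qed.

Fact diffop_freeZ f c g : diffop_free (c *: g) f = c *: diffop_free g f.
Proof. by rewrite -[c *: g]addr0 diffop_free_linear_op diffop_free0 addr0. Qed.

Fact diffop_free_sum f (I : Type) (r : seq I) (F : I -> {malg k[{cmonom V}]}) :
  diffop_free (\sum_(i <- r) F i) f = \sum_(i <- r) diffop_free (F i) f.
Proof.
elim: r => [|i r IH]; first by rewrite !big_nil diffop_free0.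
by rewrite !big_cons diffop_freeD IH.
Qed.

Fact diffop_freeMUU (c c' : k) (m m' : {cmonom V}) f :
  diffop_free (<< c *g m >> * << c' *g m' >>) f =
  diffop_free << c *g m >> (diffop_free << c' *g m' >> f).
Proof.
rewrite malgMUU.
rewrite [LHS]diffop_freeU.
rewrite [RHS]diffop_freeU.
rewrite (diffop_freeU f c' m').
rewrite diffop_word_mon.
rewrite -scalerA; congr (_ *: _); apply/esym.
exact: (linearZ_LR (diffop_word (mon_word m)) c').
Qed.

Fact diffop_freeM g h f :
  diffop_free (g * h) f = diffop_free g (diffop_free h f).
Proof.
rewrite [g]monalgE mulr_suml !diffop_free_sum; apply: eq_bigr => m _.
rewrite [h]monalgE mulr_sumr !diffop_free_sum raddf_sum; apply: eq_bigr => m' _.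
exact: diffop_freeMUU.
Qed.

Fact diffop_free1 f : diffop_free 1 f = f.
Proof.
by rewrite (_ : 1 = << monalg.one >>) // diffop_freeU scale1r mon_word1.
Qed.

Fact diffop_free_var v f : diffop_free (sym_var v) f = Lderiv v f.
Proof.
rewrite diffop_freeU scale1r (@diffop_word_perm _ [:: v]) //.
by apply/allP => w _ /=; rewrite count_mon_word monalg.cmU addn0.
Qed.

Fact diffop_free_rel c v w f :
  diffop_free (sym_var (c *: v + w) - (c *: sym_var v + sym_var w)) f = 0.
Proof.
have aux (D D' D'' dv dw : fseries) : D = -1 *: D' + D'' ->
    D' = c *: dv + dw -> D'' = c *: dv + dw -> D = 0.
  by move=> -> -> ->; rewrite scaleN1r addNr.
rewrite addrC -scaleN1r; apply: (aux _ _ _ (Lderiv v f) (Lderiv w f)).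
- exact: diffop_free_linear_op.
- apply: etrans (diffop_free_linear_op _ _ _ _) _.
  by congr (_ *: _ + _); apply: diffop_free_var.
- by apply: etrans (diffop_free_var _ _) _; apply: Lderiv_linear_dir.
Qed.

Fact diffop_free_ideal g f : sym_rel_mem g -> diffop_free g f = 0.
Proof.
pose M g := forall f, diffop_free g f = 0.
have M0 : M 0 by move=> ?; apply: diffop_free0.
have MD g1 g2 : M g1 -> M g2 -> M (g1 + g2).
  by move=> P1 P2 f'; rewrite diffop_freeD P1 P2 addr0.
have MM a g1 : M g1 -> M (a * g1).
  by move=> P1 f'; rewrite diffop_freeM P1 linear0.
by move/(_ (Ideal M0 MD MM)); apply => c v w f'; apply: diffop_free_rel.
Qed.

Lemma diffop_pi g f : diffop (quot_pi (sym_ideal V) g) f = diffop_free g f.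
Proof.
rewrite /diffop -[X in diffop_free X _](subrK g).
apply: etrans (diffop_freeD _ _ _) _.
by rewrite (diffop_free_ideal f (ideal_repr (sym_ideal V) g)) add0r.
Qed.

Lemma diffop1 f : diffop 1 f = f.
Proof.
rewrite -(rmorph1 (quot_pi (sym_ideal V))).
exact: etrans (diffop_pi _ _) (diffop_free1 _).
Qed.

Lemma diffop_inj v f : diffop (sym_inj v) f = Lderiv v f.
Proof. exact: etrans (diffop_pi _ _) (diffop_free_var _ _). Qed.

Lemma diffopM P Q f : diffop (P * Q) f = diffop P (diffop Q f).
Proof.
have [[g <-] [h <-]] := (quot_pi_surj P, quot_pi_surj Q).
rewrite -(rmorphM (quot_pi (sym_ideal V))).
apply: etrans (diffop_pi _ _) _; apply: etrans (diffop_freeM _ _ _) _.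
by apply/esym; apply: etrans (diffop_pi _ _) _; rewrite diffop_pi.
Qed.

Lemma diffop_linear_op c P Q f :
  diffop (c *: P + Q) f = c *: diffop P f + diffop Q f.
Proof.
have [[g <-] [h <-]] := (quot_pi_surj P, quot_pi_surj Q).
rewrite -(linearP (quot_pi (sym_ideal V))).
apply: etrans (diffop_pi _ _) _; apply: etrans (diffop_free_linear_op _ _ _ _) _.
by congr (_ *: _ + _); apply/esym/diffop_pi.
Qed.

Lemma diffop_is_linear P : linear (diffop P).
Proof. exact: diffop_free_is_linear. Qed.

HB.instance Definition _ P :=
  GRing.isLinear.Build k fseries fseries _ (diffop P) (diffop_is_linear P).

Lemma diffop_prod (s : seq V) f :
  diffop (\prod_(v <- s) sym_inj v) f = foldr Lderiv f s.
Proof.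
elim: s => [|v s IH]; first by rewrite big_nil diffop1.
by rewrite big_cons diffopM diffop_inj IH.
Qed.

Section Annihilator.
Variable f : fseries.

Definition ann_mem (P : sym V) : Prop := diffop P f = 0.

Fact ann_mem0 : ann_mem 0.
Proof.
rewrite /ann_mem -(subrr 1) addrC -scaleN1r diffop_linear_op scaleN1r.
exact: addNr.
Qed.

Fact ann_memD P Q : ann_mem P -> ann_mem Q -> ann_mem (P + Q).
Proof.
rewrite /ann_mem => P0 Q0.
by rewrite -[P]scale1r diffop_linear_op P0 Q0 scaler0 addr0.
Qed.

Fact ann_memM P Q : ann_mem Q -> ann_mem (P * Q).
Proof. by rewrite /ann_mem diffopM => ->; rewrite linear0. Qed.

Definition Ann : ideal (sym V) := Ideal ann_mem0 ann_memD ann_memM.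

End Annihilator.

End FormalSeries.

Fact form_power_homog (k : fieldType) (A : comPzAlgType k) n (y : 'I_n -> A) d
    (h : {scalar A}) :
  exists2 p : {mpoly k[n]}, p \is d.-homog &
    forall t : 'I_n -> k, h ((\sum_i t i *: y i) ^+ d) = p.@[t].
Proof.
elim: d h => [|d IHd] h.
  exists (h 1)%:MP => [|t]; last by rewrite expr0 mevalC.
  by rewrite -[_%:MP]mulr1 mul_mpolyC rpredZ ?dhomog1.
have hi i : exists p : {mpoly k[n]}, p \is d.-homog /\
    forall t : 'I_n -> k, h (y i * (\sum_i t i *: y i) ^+ d) = p.@[t].
  have hP : scalar (fun a : A => h (y i * a)).
    by move=> c a b; rewrite mulrDr -pz_scalerAr linearP.
  pose H : {scalar A} :=
    HB.pack (fun a : A => h (y i * a)) (GRing.isLinear.Build k A k _ _ hP).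
  by have [p pd pE] := IHd H; exists p.
have [p pP] := choice hi.
exists (\sum_i 'X_i * p i) => [|t].
  rewrite rpred_sum // => i _; rewrite -add1n; apply: dhomogM (proj1 (pP i)).
  exact: dhomog_var.
rewrite exprS mulr_suml linear_sum raddf_sum; apply: eq_bigr => i _.
by rewrite -pz_scalerAl linearZ /= (proj2 (pP i)) mevalM mevalXU.
Qed.

Section ExpStar.
Variables (k : fieldType) (V : lmodType k) (l : {scalar sym V}).

Definition exp_term (d : nat) (v : V) : k := l (d`!%:R^-1 *: sym_inj v ^+ d).

Fact exp_term_homog d : homog_poly d (exp_term d).
Proof.
move=> n u _.
have [p pd pE] := form_power_homog (fun i => sym_inj (u i)) d l.
exists (d`!%:R^-1 *: p) => [|t]; first by rewrite rpredZ.
rewrite mevalZ -pE /exp_term linearZ /= linear_sum; congr (_ * l (_ ^+ d)).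
by apply: eq_bigr => i _; rewrite linearZ.
Qed.

Definition ExpStar : fseries V := FSeries exp_term_homog.

End ExpStar.

(* Main.v *)
Require Import Defs.
From mathcomp Require Import all_boot all_algebra.
From HB Require Import structures.
From mathcomp Require Import boolp.
Import GRing.Theory.
Local Open Scope ring_scope.

(** Write m for a linear form on Sym(V) and m_P for the form Q |-> m (P * Q).
    The exponential turns multiplication into differentiation:
      D_P (Exp^* m) = Exp^* (m_P).
    For P = v in V this is a comparison of the coefficients of t in
    m ((x + t v)^(d+1) / (d+1)!) ([Lderiv_ExpStar]); the general case follows
    since both sides are linear and multiplicative in P ([diffop_ExpStar]).

    The constant term of Exp^* (m_P) is m P.  Hence if D_P (Exp^* m) = 0, then
    D_Q D_P (Exp^* m) = D_(QP) (Exp^* m) = 0 for every Q, and reading off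
    constant terms gives m (Q * P) = 0 for every Q.  So Ann (Exp^* m) is the
    kernel of the pairing (P, Q) |-> m (P * Q) on Sym(V) ([Ann_ExpStarP]);
    passing through the operators in this way replaces the fact that Sym(V) is
    spanned by powers of vectors.  When m is the composite of l with pi, where
    pi is surjective and the pairing of l is non-degenerate, this kernel is
    ker pi, and the first isomorphism theorem ([first_isomorphism])
    concludes. *)

(** * Exponentials of linear forms and differential operators *)

(** [exprZn] without the assumption that 1 != 0 in A. *)
Lemma pz_exprZn (k : pzRingType) (A : comPzAlgType k) (c : k) (a : A) n :
  (c *: a) ^+ n = c ^+ n *: a ^+ n.
Proof.
elim: n => [|n IHn]; first by rewrite !expr0 scale1r.
by rewrite !exprS IHn -pz_scalerAl -pz_scalerAr scalerA.
Qed.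

Fact mul_form_is_scalar {k : fieldType} {A : comPzAlgType k} (m : {scalar A})
    (a : A) : scalar (fun b => m (a * b)).
Proof. by move=> c b b'; rewrite mulrDr -pz_scalerAr linearP. Qed.

(** The form m_a of the introduction.  It is built as a bundled scalar form, so
    that it can be given to [ExpStar] and iterated. *)
Definition mul_form {k : fieldType} {A : comPzAlgType k} (m : {scalar A})
    (a : A) : {scalar A} :=
  HB.pack (fun b => m (a * b))
    (GRing.isLinear.Build k A k _ _ (mul_form_is_scalar m a)).

Lemma mul_form_linear {k : fieldType} {A : comPzAlgType k} (m : {scalar A})
    c a a' b :
  mul_form m (c *: a + a') b = c * mul_form m a b + mul_form m a' b.
Proof. by rewrite /= mulrDl -pz_scalerAl linearP. Qed.

Lemma mul_form1 {k : fieldType} {A : comPzAlgType k} (m : {scalar A}) b :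
  mul_form m 1 b = m b.
Proof. by rewrite /= mul1r. Qed.

Lemma mul_formM {k : fieldType} {A : comPzAlgType k} (m : {scalar A}) a a' b :
  mul_form (mul_form m a) a' b = mul_form m (a' * a) b.
Proof. by rewrite /= mulrA [a * a']mulrC. Qed.

(** The expansion of m ((x + t y)^(n+1)) in powers of t.  Only the coefficient
    of t is kept, since it is the one that defines the directional
    derivative. *)
Lemma form_power_line {k : fieldType} {A : comPzAlgType k} (m : {scalar A})
    (x y : A) n :
  exists2 q : {poly k}, forall t, m ((x + t *: y) ^+ n.+1) = q.[t] &
    q`_1 = mul_form m y (x ^+ n) *+ n.+1.
Proof.
exists (\poly_(i < n.+2) (m (x ^+ (n.+1 - i) * y ^+ i) *+ 'C(n.+1, i))) => [t|].
  rewrite horner_poly exprDn raddf_sum; apply: eq_bigr => i _ /=.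
  by rewrite pz_exprZn -pz_scalerAr raddfMn /= linearZ /= mulrC -mulrnAl.
by rewrite coef_poly /= subSS subn0 bin1 expr1 mulrC.
Qed.

Section DiffExp.
Variables (k : fieldType) (V : lmodType k).
Implicit Types (m : {scalar sym V}) (P Q : sym V).

Lemma ExpStarE m d v : ExpStar m d v = d`!%:R^-1 * m (sym_inj v ^+ d).
Proof. by rewrite /= /exp_term linearZ. Qed.

Lemma ExpStar0 m v : ExpStar m 0%N v = m 1.
Proof. by rewrite ExpStarE expr0 fact0 invr1 mul1r. Qed.

Lemma ExpStar_linear m1 m2 m3 c :
  (forall P, m3 P = c * m1 P + m2 P) ->
  ExpStar m3 = c *: ExpStar m1 + ExpStar m2.
Proof.
move=> m3E; apply/fseriesP => d v.
by rewrite fsDE fsZE !ExpStarE m3E mulrDr mulrCA.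
Qed.

Lemma ExpStar_ext m1 m2 : m1 =1 m2 -> ExpStar m1 = ExpStar m2.
Proof. by move=> m12; apply/fseriesP => d v; rewrite !ExpStarE m12. Qed.

Hypothesis char0 : [pchar k] =i pred0.

(** (d+1) / (d+1)! = 1 / d!, with d+1 the binomial coefficient of t. *)
Let inv_factS d (y : k) : (d.+1)`!%:R^-1 * (y *+ d.+1) = d`!%:R^-1 * y.
Proof.
rewrite -[y *+ _]mulr_natl factS natrM invfM mulrA; congr (_ * _).
by rewrite mulrAC mulVf ?mul1r ?((pcharf0P k).1 char0).
Qed.

(** The infinitesimal case of D_P (Exp^* m) = Exp^* (m_P). *)
Lemma Lderiv_ExpStar m v :
  Lderiv char0 v (ExpStar m) = ExpStar (mul_form m (sym_inj v)).
Proof.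
apply/fseriesP => d x; rewrite LderivE ExpStarE.
have [q qE q1] := form_power_line m (sym_inj x) (sym_inj v) d.
rewrite (dir_deriv_unique char0 (q := (d.+1)`!%:R^-1 *: q)) => [|t].
  by rewrite coefZ q1 inv_factS.
have sE : sym_inj (x + t *: v) = sym_inj x + t *: sym_inj v.
  by rewrite addrC sym_inj_is_linear addrC.
by rewrite ExpStarE sE qE hornerZ.
Qed.

(** By linearity in P, it is enough to treat products of vectors, where the
    derivatives are taken one at a time: each of them multiplies the argument
    of the form by one more factor. *)
Lemma diffop_ExpStar m P :
  diffop char0 P (ExpStar m) = ExpStar (mul_form m P).
Proof.
elim/sym_ind: P => [c P Q IHP IHQ|s].
  rewrite diffop_linear_op IHP IHQ; apply/esym/ExpStar_linear => R.
  exact: mul_form_linear.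
rewrite diffop_prod; elim: s => [|v s IHs].
  by apply: ExpStar_ext => R; rewrite big_nil mul_form1.
rewrite [LHS]/= IHs Lderiv_ExpStar; apply: ExpStar_ext => R.
by rewrite big_cons mul_formM.
Qed.

(** The annihilator is an ideal, so it is controlled by the constant terms of
    the series D_(QP) (Exp^* m) alone. *)
Lemma Ann_ExpStarP m P :
  Ann char0 (ExpStar m) P <-> forall Q, m (P * Q) = 0.
Proof.
split=> [P0 Q|mP0].
  have := ideal_memM Q P0; rewrite /= /ann_mem diffop_ExpStar => QP0.
  have := ExpStar0 (mul_form m (Q * P)) 0; rewrite QP0 fs0E /=.
  by rewrite mulr1 mulrC.
rewrite /= /ann_mem diffop_ExpStar; apply/fseriesP => d v.
by rewrite ExpStarE /= mP0 mulr0.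
Qed.

End DiffExp.

(** * Quotients by kernels *)

(** The isomorphism sends f x to the class of x; the representative x is picked
    by a choice function g. *)
Lemma first_isomorphism (k : pzRingType) (R A : comPzAlgType k) (I : ideal R)
    (f : {linear R -> A}) :
  monoid_morphism f -> (forall a, exists x, f x = a) ->
  (forall x, I x <-> f x = 0) ->
  exists phi : {linear A -> alg_quot I}, monoid_morphism phi /\ bijective phi.
Proof.
move=> [f1 fM] /choice[g gK] If.
have piE x y : f x = f y -> quot_pi I x = quot_pi I y.
  by move=> fxy; apply/quot_piP/If; rewrite linearB /= fxy subrr.
pose phi a := quot_pi I (g a).
have phi_linear : linear phi.
  by move=> c a b; rewrite /phi -linearP; apply: piE; rewrite linearP /= !gK.
pose Phi : {linear A -> alg_quot I} :=
  HB.pack phi (GRing.isLinear.Build k A (alg_quot I) _ phi phi_linear).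
exists Phi; split.
  split=> [|a b]; rewrite /= /phi.
    by rewrite -(rmorph1 (quot_pi I)); apply: piE; rewrite gK f1.
  by rewrite -rmorphM; apply: piE; rewrite fM !gK.
exists (fun q => f (repr q)) => [a|q].
  apply/eqP; rewrite -subr_eq0 -{2}(gK a) -linearB; apply/eqP/If.
  exact: ideal_repr.
have [x <-] := quot_pi_surj q; apply: piE; rewrite gK.
by apply/eqP; rewrite -subr_eq0 -linearB; apply/eqP/If/ideal_repr.
Qed.

Theorem theorem4p2 (k : fieldType) (char0 : [pchar k] =i pred0)
  (A : comPzAlgType k) (l : {scalar A}) (l_gorenstein : gorenstein_duality l)
  (V : lmodType k) (pi : {linear sym V -> A}) (pi_mor : monoid_morphism pi)
  (pi_surj : forall a : A, exists P : sym V, pi P = a) :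
  exists phi : {linear A -> alg_quot (Ann char0 (ExpStar (l \o pi)))},
    monoid_morphism phi /\ bijective phi.
Proof.
have [_ piM] := pi_mor.
apply: (first_isomorphism _ _ _ _ _ pi_mor pi_surj) => P; rewrite Ann_ExpStarP.
split=> [lP0|piP0 Q]; last by rewrite /= piM piP0 mul0r linear0.
by apply: l_gorenstein => b; have [Q <-] := pi_surj b; rewrite -piM; apply: lP0.
Qed.
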